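(* Consider the family of density states on $\mathbb{C}^2\otimes\mathbb{C}^2$ $$ \rho_t=\begin{pmatrix} 0&0&0&0\\ 0&a&\tfrac12 c\,e^{i\phi}&0\\ 0&\tfrac12 c\,e^{-i\phi}&b&0\\ 0&0&0&1-a-b\end{pmatrix}, \qquad 0\le a+b\le 1,\quad 0\le c\le 1,\quad 4ab\ge c, $$ with $a,b,c,\phi$ real. The concurrence $C$ and the von Neumann entropy $S$ of the family of states $\rho_t$ are not independent in all the space of density states; that is, there is a nonempty set of states (points of the family) at which $dS\wedge dC=0$, so that $S$ and $C$ are not functionally independent there.
   Context: Matrices on $\mathbb{C}^2\otimes\mathbb{C}^2\cong\mathbb{C}^4$ are written in the standard product basis. The density states are regarded as a subset of the real vector space $\mathfrak{u}^*(4)$, the dual of the Lie algebra of the unitary group $U(4)$ (identified with Hermitian $4\times4$ matrices by means of the trace). The family $\rho_t$ is regarded as a $4$-dimensional submanifold $\mathcal{S}$ of the set of density states, with adapted coordinates $(a,b,c,\phi)$. The von Neumann entropy of a density matrix $\rho$ is, with the sign convention used here, $S(\rho)=\operatorname{Tr}(\rho\log\rho)$ (with $0\log 0=0$). The concurrence of a density matrix $\rho$ is $C(\rho)=\max\bigl(0,\,2\lambda_{\max}(\hat\rho)-\operatorname{Tr}(\hat\rho)\bigr)$, where $\hat\rho=\sqrt{(\sigma_2\otimes\sigma_2)\,\rho^*\,(\sigma_2\otimes\sigma_2)\,\rho}$, $\sigma_2=\begin{pmatrix}0&-i\\ i&0\end{pmatrix}$, $\rho^*$ is the entrywise complex conjugate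 of $\rho$, and $\lambda_{\max}(\hat\rho)$ is the largest eigenvalue of $\hat\rho$. On the family one has $C(\rho_t)=c$. Two functions $f_1,f_2$ are independent at a point $p$ if $(df_1\wedge df_2)(p)\neq 0$. Here $d$ is the ordinary exterior differential of the real manifold $\mathfrak{u}^*(4)$, and $dS\wedge dC$ is evaluated on the submanifold $\mathcal{S}$, that is, with $S$ and $C$ expressed as functions of $(a,b,c,\phi)$. (For two quantum observables $A,B$, with associated functions $f_A(\psi)=\langle\psi|A|\psi\rangle$ and $f_B(\psi)=\langle\psi|B|\psi\rangle$ on the Hilbert space, functional independence is defined as $df_A\wedge df_B\neq0$ on a dense submanifold of the Hilbert space.) *)

(* Defs.v *)
From HB Require Import structures.
From mathcomp Require Export all_boot all_order all_algebra.
From mathcomp Require Export complex mxtens.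
From mathcomp Require Export all_classical all_reals all_analysis.
From mathcomp Require Import ring lra.

#[export] Set Implicit Arguments.
#[export] Unset Strict Implicit.
#[export] Unset Printing Implicit Defensive.
Export Order.TTheory GRing.Theory Num.Theory.
Export numFieldNormedType.Exports.
Open Scope classical_set_scope.
Open Scope ring_scope.
Open Scope complex_scope.

(* [diag_by M (P, d)]: M = P^-1 diag(d) P with d real; the d_i are then the
   eigenvalues of M.  Every Hermitian matrix, and every product of two positive
   semidefinite matrices, has such a decomposition. *)
Definition diag_by (R : realType) n (M : 'M[R[i]]_n)
    (Pd : 'M[R[i]]_n * 'rV[R]_n) : Prop :=
  Pd.1 \in unitmx /\
  M = invmx Pd.1 *m diag_mx (map_mx (real_complex R) Pd.2) *m Pd.1.

(* Functional calculus f(M) = P^-1 diag(f(d)) P, for M diagonalizable with real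
   eigenvalues (M need not be Hermitian).  By [mxfunE] the result does not
   depend on the decomposition; for other M the value is irrelevant. *)
Definition mxfun (R : realType) n (f : R -> R) (M : 'M[R[i]]_n) : 'M[R[i]]_n :=
  let Pd := xget (1%:M, 0) [set Pd | diag_by M Pd] in
  invmx Pd.1 *m diag_mx (map_mx (fun x => (f x)%:C) Pd.2) *m Pd.1.

Lemma mxfunE (R : realType) n (f : R -> R) (M P : 'M[R[i]]_n) (d : 'rV[R]_n) :
  diag_by M (P, d) ->
  mxfun f M = invmx P *m diag_mx (map_mx (fun x => (f x)%:C) d) *m P.
Proof.
move=> MPd; rewrite /mxfun.
case: xgetP => [[Q e] _ | /(_ (P, d)) //]; case: MPd => /= uP ->.
case=> /= uQ PQ.
have {}PQ : (Q *m invmx P) *m diag_mx (map_mx (real_complex R) d) =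
            diag_mx (map_mx (real_complex R) e) *m (Q *m invmx P).
  have := congr1 (fun X => Q *m X *m invmx P) PQ.
  by rewrite -!mulmxA mulmxV // mulmx1 mulKVmx //.
suff fPQ : (Q *m invmx P) *m diag_mx (map_mx (fun x => (f x)%:C) d) =
    diag_mx (map_mx (fun x => (f x)%:C) e) *m (Q *m invmx P).
  have := congr1 (fun X => invmx Q *m X *m P) fPQ.
  by rewrite -!mulmxA mulKmx // mulVmx // mulmx1 => ->.
apply/matrixP => i j; move/matrixP/(_ i j): PQ.
rewrite !mul_mx_diag !mul_diag_mx !mxE.
set q := \sum_(_ < _) _; have [->|q0] := eqVneq q 0; first by rewrite !mulr0 !mul0r.
by rewrite mulrC => /(mulIf q0) [->]; rewrite mulrC.
Qed.

(* Sign convention: Tr(rho log rho), without the usual minus sign.  An eigenvalue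
   0 contributes 0 * ln 0 = 0. *)
Definition entropy (R : realType) n (rho : 'M[R[i]]_n) : R :=
  complex.Re (\tr (rho *m mxfun (@ln R) rho)).

Definition pauli2 (R : realType) : 'M[R[i]]_2 :=
  \matrix_(i, j) if (i == 0) && (j == 1) then 0 -i* 1
                 else if (i == 1) && (j == 0) then 0 +i* 1 else 0.

Definition sigma22 (R : realType) : 'M[R[i]]_4 := pauli2 R *t pauli2 R.

(* Matrices on C^2 (x) C^2 are indexed by 'I_4 in the order 00, 01, 10, 11, as in
   [tensmx]. *)
Definition rho_hat (R : realType) (rho : 'M[R[i]]_4) : 'M[R[i]]_4 :=
  mxfun (@Num.sqrt R)
    (sigma22 R *m map_mx (@conjc R) rho *m sigma22 R *m rho).

Definition lambda_max (R : realType) n (M : 'M[R[i]]_n) : R :=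
  sup [set x : R | eigenvalue M x%:C].

Definition concurrence (R : realType) (rho : 'M[R[i]]_4) : R :=
  Num.max 0 (2 * lambda_max (rho_hat rho) - complex.Re (\tr (rho_hat rho))).

Definition density_state (R : realType) n (rho : 'M[R[i]]_n) : Prop :=
  [/\ map_mx (@conjc R) rho^T = rho,
      forall v : 'cV[R[i]]_n, 0 <= (map_mx (@conjc R) v^T *m rho *m v) 0 0
    & \tr rho = 1].

(* A parameter p : 'rV[R]_4 is (a, b, c, phi). *)
Definition pa (R : realType) (p : 'rV[R]_4) : R := p 0 (inord 0).
Definition pb (R : realType) (p : 'rV[R]_4) : R := p 0 (inord 1).
Definition pc (R : realType) (p : 'rV[R]_4) : R := p 0 (inord 2).
Definition pphi (R : realType) (p : 'rV[R]_4) : R := p 0 (inord 3).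

(* The family is a 4-manifold with coordinates (a, b, c, phi) on the interior of
   this domain; differentials are only taken there. *)
Definition param_dom (R : realType) : set 'rV[R]_4 :=
  [set p | [/\ 0 <= pa p + pb p <= 1, 0 <= pc p <= 1
             & pc p <= 4 * pa p * pb p]].
Arguments param_dom : clear implicits.

Definition rho_t (R : realType) (p : 'rV[R]_4) : 'M[R[i]]_4 :=
  \matrix_(i, j)
    match val i, val j with
    | 1, 1 => (pa p)%:C
    | 1, 2 => (pc p / 2)%:C * (cos (pphi p) +i* sin (pphi p))
    | 2, 1 => (pc p / 2)%:C * (cos (pphi p) -i* sin (pphi p))
    | 2, 2 => (pb p)%:C
    | 3, 3 => (1 - pa p - pb p)%:C
    | _, _ => 0
    end.

Lemma rho_t_psd_aux (R : realType) (a b c C S x1 y1 x2 y2 : R) :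
  0 <= a -> 0 <= b -> 0 <= c <= 1 -> c <= 4 * a * b -> C ^+ 2 + S ^+ 2 = 1 ->
  0 <= a * (x1 ^+ 2 + y1 ^+ 2) + b * (x2 ^+ 2 + y2 ^+ 2)
     + c * (C * (x1 * x2 + y1 * y2) + S * (y1 * x2 - x1 * y2)).
Proof.
move=> a0 b0 c01 cab CS.
have [aE|an0] := eqVneq a 0.
  have -> : c = 0 by move: cab c01; rewrite aE; lra.
  rewrite aE; have := mulr_ge0 b0 (addr_ge0 (sqr_ge0 x2) (sqr_ge0 y2)); lra.
have ap : 0 < a by rewrite lt_neqAle eq_sym an0.
rewrite -(pmulr_rge0 _ ap).
set X := C * x2 - S * y2; set Y := C * y2 + S * x2.
have XY : x2 ^+ 2 + y2 ^+ 2 = X ^+ 2 + Y ^+ 2.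
  rewrite -[LHS]mul1r -CS /X /Y; ring.
rewrite XY.
have -> : a * (a * (x1 ^+ 2 + y1 ^+ 2) + b * (X ^+ 2 + Y ^+ 2)
     + c * (C * (x1 * x2 + y1 * y2) + S * (y1 * x2 - x1 * y2))) =
  (a * x1 + c / 2 * X) ^+ 2 + (a * y1 + c / 2 * Y) ^+ 2
   + (a * b - c ^+ 2 / 4) * (X ^+ 2 + Y ^+ 2).
  rewrite /X /Y. by field.
have cc : c ^+ 2 <= c by rewrite expr2 ler_piMl; case/andP: c01.
have k0 : 0 <= a * b - c ^+ 2 / 4 by lra.
by apply: addr_ge0; [|apply: mulr_ge0 => //]; apply: addr_ge0; exact: sqr_ge0.
Qed.

Lemma rho_t_density (R : realType) (p : 'rV[R]_4) :
  param_dom R p -> density_state (rho_t p).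
Proof.
rewrite /param_dom /rho_t /=.
move: (pa p) (pb p) (pc p) (pphi p) => a b c phi [ab c01 cab]; split.
- apply/matrixP => -[[|[|[|[|//]]]] ?] [[|[|[|[|//]]]] ?]; rewrite !mxE //=;
  by simpc; rewrite ?oppr0 ?opprK.
- move=> v; rewrite !mxE !big_ord_recl !big_ord0 !mxE !big_ord_recl !big_ord0 !mxE /=.
  move: (v _ _) (v _ _) (v _ _) (v _ _)  => [x0 y0] [x1 y1] [x2 y2] [x3 y3].
  rewrite /bump /=; simpc.
  have a0 : 0 <= a by nra.
  have b0 : 0 <= b by nra.
  have k0 : 0 <= 1 - a - b by lra.
  have := rho_t_psd_aux x2 y2 x1 y1 a0 b0 c01 cab (cos2Dsin2 phi).
  have := mulr_ge0 k0 (addr_ge0 (sqr_ge0 x0) (sqr_ge0 y0)).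
  move=> h1 h2; apply/andP; split; first by apply/eqP; field.
  by have := addr_ge0 h1 h2; congr (0 <= _); field.
- rewrite /mxtrace !big_ord_recl big_ord0 !mxE /bump /=; simpc.
  by congr (_ +i* _); ring.
Qed.

Definition wedge (R : realType) (V : lmodType R) (alpha beta : V -> R) (u v : V) : R :=
  alpha u * beta v - alpha v * beta u.

(* The value ['d f p] is meaningful only where f is differentiable. *)
Definition dwedge (R : realType) (V : normedModType R) (f g : V -> R) (p : V) :
  V -> V -> R := wedge ('d f p) ('d g p).

Definition independent_at (R : realType) (V : normedModType R)
    (f g : V -> R) (p : V) : Prop :=
  dwedge f g p <> (fun _ _ => 0).

(* S and C in the coordinates (a, b, c, phi). *)
Definition S_t (R : realType) (p : 'rV[R]_4) : R := entropy (rho_t p).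
Definition C_t (R : realType) (p : 'rV[R]_4) : R := concurrence (rho_t p).

(* Main.v *)
Require Import Defs.
From HB Require Import structures.
From mathcomp Require Import ring lra.

(** For [c > 0] and [c^2 < 4ab] the spectrum of [rho_t] is
    [0, (a + b + r) / 2, (a + b - r) / 2, 1 - a - b] with
    [r = sqrt ((a - b)^2 + c^2)], and that of [rho_hat] is
    [0, sqrt (ab) + c/2, sqrt (ab) - c/2, 0], so that [C = c].  On the diagonal
    [a = b] the differential of [r] is [dc], hence
    [dS = ln (l1 * l2 / l3^2) / 2 * (da + db) + ln (l1 / l2) / 2 * dc]
    where [l1, l2, l3] are the nonzero eigenvalues of [rho_t].  Thus [dS] is
    proportional to [dC] wherever [a = b] and [l1 * l2 = l3^2]; such a point is
    [a = b = 5/14, c = 3/7], with eigenvalues [4/7, 1/7, 2/7]. *)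

(** * Matrices with a central 2 x 2 block, and their diagonalisation *)

Definition cblock (K : nzRingType) (t0 a b c d t3 : K) : 'M[K]_4 :=
  \matrix_(i, j)
    match val i, val j with
    | 0, 0 => t0 | 1, 1 => a | 1, 2 => b | 2, 1 => c | 2, 2 => d | 3, 3 => t3
    | _, _ => 0
    end.

Lemma cblock1 (K : nzRingType) : cblock 1 1 0 0 1 1 = 1%:M :> 'M[K]_4.
Proof.
by apply/matrixP => -[[|[|[|[|//]]]] ?] [[|[|[|[|//]]]] ?]; rewrite !mxE.
Qed.

(** Closure under products reduces the matrix computations below to a 2 x 2 block and two corner
    scalars. *)
Lemma mul_cblock (K : comNzRingType) (t0 a b c d t3 t0' a' b' c' d' t3' : K) :
  cblock t0 a b c d t3 *m cblock t0' a' b' c' d' t3' =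
  cblock (t0 * t0') (a * a' + b * c') (a * b' + b * d')
         (c * a' + d * c') (c * b' + d * d') (t3 * t3').
Proof.
apply/matrixP => -[[|[|[|[|//]]]] ?] [[|[|[|[|//]]]] ?];
  rewrite !mxE !big_ord_recl big_ord0 !mxE /bump /=; ring.
Qed.

(** The two equations make [l1] and [l2] roots of the characteristic polynomial of the middle block;
    [c != 0] and [l1 != l2] make the chosen left eigenvectors independent. *)
Lemma diag_by_cblock (R : realType) (t0 t3 l1 l2 : R) (a b c d : R[i]) :
  c != 0 -> l1 != l2 ->
  (l1%:C - a) * (l1%:C - d) = b * c -> (l2%:C - a) * (l2%:C - d) = b * c ->
  exists P, diag_by (cblock t0%:C a b c d t3%:C)
    (P, \row_j [:: t0; l1; l2; t3]`_j).
Proof.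
move=> c0 l12 e1 e2.
(* The rows [(c, l_k - a)] of [P] are left eigenvectors of the middle block. *)
pose P : 'M[R[i]]_4 := cblock 1 c (l1%:C - a) c (l2%:C - a) 1.
have l12' : l2%:C - l1%:C != 0 :> R[i].
  by rewrite subr_eq0 eq_sym; apply: contra l12 => /eqP[->].
have uP : P \in unitmx.
  (* The second factor inverts the middle block of [P] as adjugate over determinant, the determinant
     being [c * (l2 - l1)]. *)
  have : P *m (cblock 1 ((l2%:C - a) / (c * (l2%:C - l1%:C)))
     (- (l1%:C - a) / (c * (l2%:C - l1%:C))) (- c / (c * (l2%:C - l1%:C)))
     (c / (c * (l2%:C - l1%:C))) 1) = 1%:M.
    rewrite mul_cblock -cblock1; congr cblock; field; rewrite ?c0 ?l12' //.
  by case/mulmx1_unit.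
exists P; split => //=.
rewrite (_ : diag_mx _ = cblock t0%:C l1%:C 0 0 l2%:C t3%:C); last first.
  by apply/matrixP => -[[|[|[|[|//]]]] ?] [[|[|[|[|//]]]] ?]; rewrite !mxE.
rewrite -mulmxA; apply: (canRL (mulKmx uP)); rewrite !mul_cblock.
congr cblock; try ring.
- by rewrite [c * b]mulrC -e1; ring.
- by rewrite [c * b]mulrC -e2; ring.
Qed.

(** * Entropy, trace and spectrum read off a diagonalisation *)

Lemma diag_by_entropy (R : realType) n (M P : 'M[R[i]]_n) (d : 'rV[R]_n) :
  diag_by M (P, d) -> entropy M = \sum_i d 0 i * ln (d 0 i).
Proof.
move=> MPd; rewrite /entropy (mxfunE _ MPd); case: MPd => /= uP ->.
rewrite !mulmxA mulmxK // mxtrace_mulC -!mulmxA mulKVmx // mulmx_diag.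
rewrite mxtrace_diag raddf_sum /=; apply: eq_bigr => i _.
by rewrite !mxE /= !mul0r subr0.
Qed.

Lemma diag_by_mxfun (R : realType) n f (M P : 'M[R[i]]_n) (d : 'rV[R]_n) :
  diag_by M (P, d) -> diag_by (mxfun f M) (P, map_mx f d).
Proof.
move=> MPd; split; first by case: MPd.
by rewrite (mxfunE _ MPd) /= -map_mx_comp.
Qed.

Lemma diag_by_tr (R : realType) n (M P : 'M[R[i]]_n) (d : 'rV[R]_n) :
  diag_by M (P, d) -> complex.Re (\tr M) = \sum_i d 0 i.
Proof.
case=> /= uP ->.
rewrite mxtrace_mulC mulmxA mulmxV // mul1mx mxtrace_diag raddf_sum /=.
by apply: eq_bigr => i _; rewrite mxE.
Qed.

(** Multiplication by [invmx P] turns an eigenvector of [M] into one of the diagonal matrix, where a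
    nonzero coordinate [i] forces the eigenvalue [d 0 i]. Conversely, row [i] of [P] is an
    eigenvector. *)
Lemma diag_by_eigenvalue (R : realType) n (M P : 'M[R[i]]_n) (d : 'rV[R]_n) :
  diag_by M (P, d) ->
  [set x : R | eigenvalue M x%:C] = [set d 0 i | i in [set: 'I_n]].
Proof.
case=> /= uP ->; apply/seteqP; split => x /=.
  case/eigenvalueP => v; rewrite !mulmxA => vM v0.
  pose w := v *m invmx P.
  have wD : w *m diag_mx (map_mx (real_complex R) d) = x%:C *: w.
    by rewrite -[LHS](mulmxK uP) vM -scalemxAl.
  have /rV0Pn[i wi] : w != 0.
    by apply: contra v0 => /eqP w0; rewrite -[v](mulmxKV uP) -/w w0 mul0mx.
  clearbody w; exists i => //; move/rowP/(_ i): wD; rewrite mul_mx_diag !mxE.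
  by rewrite mulrC => /(mulIf wi) [].
case=> i _ <-; apply/eigenvalueP; exists (delta_mx 0 i *m P).
  rewrite !mulmxA mulmxK // -[_ *m diag_mx _]rowE row_diag_mx mxE -scalemxAl //.
apply: contraTneq (oner_neq0 R) => v0.
have := congr1 (fun v => (v *m invmx P) 0 i) v0.
by rewrite mulmxK // mul0mx !mxE !eqxx /= => /eqP; rewrite oner_eq0.
Qed.

Lemma diag_by_lambda_max (R : realType) n (M P : 'M[R[i]]_n) (d : 'rV[R]_n) k :
  diag_by M (P, d) -> (forall i, d 0 i <= d 0 k) -> lambda_max M = d 0 k.
Proof.
move=> MPd dk; rewrite /lambda_max (diag_by_eigenvalue MPd).
apply/eqP; rewrite eq_le; apply/andP; split.
  by apply: ge_sup => [|_ [i _ <-]]; [exists (d 0 k), k|].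
by apply: ub_le_sup; [exists (d 0 k) => _ [i _ <-]|exists k].
Qed.

(** * The spin flip on block matrices *)

Lemma sigma22E (R : realType) : sigma22 R = \matrix_(i, j)
    match val i, val j with
    | 0, 3 | 3, 0 => -1 | 1, 2 | 2, 1 => 1 | _, _ => 0
    end.
Proof.
apply/matrixP => -[[|[|[|[|//]]]] ?] [[|[|[|[|//]]]] ?];
  by rewrite !mxE /=; simpc; rewrite ?oppr0.
Qed.

(** Up to signs, [sigma22] reverses the order of the basis, and the signs cancel on this block
    shape. *)
Lemma sigma22_conj (R : realType) (t0 a b c d t3 : R[i]) :
  sigma22 R *m cblock t0 a b c d t3 *m sigma22 R = cblock t3 d c b a t0.
Proof.
have ss : sigma22 R *m sigma22 R = 1%:M.
  rewrite sigma22E; apply/matrixP => -[[|[|[|[|//]]]] ?] [[|[|[|[|//]]]] ?];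
  by rewrite !mxE !big_ord_recl big_ord0 !mxE /bump /=; ring.
have sc : sigma22 R *m cblock t0 a b c d t3 = cblock t3 d c b a t0 *m sigma22 R.
  rewrite sigma22E; apply/matrixP => -[[|[|[|[|//]]]] ?] [[|[|[|[|//]]]] ?];
  by rewrite !mxE !big_ord_recl !big_ord0 !mxE /bump /=; ring.
by rewrite sc -mulmxA ss mulmx1.
Qed.

Lemma map_cblock (K L : nzRingType) (f : {rmorphism K -> L})
    (t0 a b c d t3 : K) :
  map_mx f (cblock t0 a b c d t3) =
  cblock (f t0) (f a) (f b) (f c) (f d) (f t3).
Proof.
by apply/matrixP => -[[|[|[|[|//]]]] ?] [[|[|[|[|//]]]] ?];
  rewrite !mxE ?rmorph0.
Qed.

(** * Closed forms of the entropy and the concurrence on the family *)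

Definition coherence (R : realType) (p : 'rV[R]_4) : R[i] :=
  (pc p / 2)%:C * (cos (pphi p) +i* sin (pphi p)).

Lemma rho_tE (R : realType) (p : 'rV[R]_4) :
  rho_t p = cblock 0%:C (pa p)%:C (coherence p) (conjc (coherence p)) (pb p)%:C
                   (1 - pa p - pb p)%:C.
Proof.
apply/matrixP => -[[|[|[|[|//]]]] ?] [[|[|[|[|//]]]] ?]; rewrite !mxE //=.
by rewrite /coherence; simpc.
Qed.

(** The phases cancel, which removes [phi] from the closed forms of S and C. *)
Lemma coherence_conj (R : realType) (p : 'rV[R]_4) :
  coherence p * conjc (coherence p) = (pc p ^+ 2 / 4)%:C.
Proof.
rewrite /coherence; simpc; congr (_ +i* _); last by ring.
transitivity (pc p ^+ 2 / 4 * (cos (pphi p) ^+ 2 + sin (pphi p) ^+ 2)).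
  by field.
by rewrite cos2Dsin2 mulr1.
Qed.

Lemma coherence_neq0 (R : realType) (p : 'rV[R]_4) :
  pc p != 0 -> conjc (coherence p) != 0.
Proof.
move=> c0; apply: contraNneq c0 => z0.
have := coherence_conj p; rewrite z0 mulr0 => -[] /esym /eqP.
by rewrite mulf_eq0 invr_eq0 expf_eq0 /= pnatr_eq0 orbF.
Qed.

(** Difference of the two eigenvalues of the middle block: the square root of its discriminant
    [(a + b)^2 - 4 (a b - c^2 / 4)]. *)
Definition gap (R : realType) (p : 'rV[R]_4) : R :=
  Num.sqrt ((pa p - pb p) ^+ 2 + pc p ^+ 2).

(** From [pc p != 0] come both a nonzero off-diagonal entry and a positive gap, as [diag_by_cblock]
    requires. *)
Lemma S_tE (R : realType) (p : 'rV[R]_4) : pc p != 0 ->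
  S_t p = (pa p + pb p + gap p) / 2 * ln ((pa p + pb p + gap p) / 2) +
          (pa p + pb p - gap p) / 2 * ln ((pa p + pb p - gap p) / 2) +
          (1 - pa p - pb p) * ln (1 - pa p - pb p).
Proof.
move=> c0.
have r0 : 0 < (pa p - pb p) ^+ 2 + pc p ^+ 2.
  by rewrite ltr_wpDl ?sqr_ge0 // lt_neqAle sqr_ge0 eq_sym expf_neq0.
have rE : gap p ^+ 2 = (pa p - pb p) ^+ 2 + pc p ^+ 2.
  by rewrite sqr_sqrtr // ltW.
have rgt0 : 0 < gap p by rewrite sqrtr_gt0.
rewrite /S_t rho_tE.
have [||||P /diag_by_entropy ->] := @diag_by_cblock R 0 (1 - pa p - pb p)
  ((pa p + pb p + gap p) / 2) ((pa p + pb p - gap p) / 2) (pa p)%:C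
  (coherence p) (conjc (coherence p)) (pb p)%:C.
- exact: coherence_neq0.
- by apply/eqP; lra.
- by rewrite coherence_conj; simpc; congr (_ +i* _); nra.
- by rewrite coherence_conj; simpc; congr (_ +i* _); nra.
- by rewrite !big_ord_recl big_ord0 !mxE /= mul0r add0r addr0 !addrA.
Qed.

(** With [z] the coherence and [s = sqrt (a b)], the product under the root has zero corners and
    middle rows [(a b + c^2 / 4, 2 b z)] and [(2 a conj z, a b + c^2 / 4)], hence eigenvalues
    [(s + c / 2)^2] and [(s - c / 2)^2]. The strict bound gives [c / 2 < s], so the roots are
    [s + c / 2] and [s - c / 2], and [2 (s + c / 2) - 2 s = c]. *)
Lemma C_tE (R : realType) (p : 'rV[R]_4) :
  0 < pa p -> 0 < pb p -> 0 < pc p -> pc p ^+ 2 < 4 * pa p * pb p ->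
  C_t p = pc p.
Proof.
move=> a0 b0 c0 cab.
set s := Num.sqrt (pa p * pb p).
have sE : s ^+ 2 = pa p * pb p by rewrite sqr_sqrtr // mulr_ge0 ?ltW.
have s0 : 0 < s by rewrite sqrtr_gt0 mulr_gt0.
have cs : pc p / 2 < s by nra.
rewrite /C_t /concurrence rho_tE.
have rhoconj : map_mx (@conjc R) (cblock 0%:C (pa p)%:C (coherence p)
   (conjc (coherence p)) (pb p)%:C (1 - pa p - pb p)%:C) =
   cblock 0%:C (pa p)%:C (conjc (coherence p)) (coherence p) (pb p)%:C
    (1 - pa p - pb p)%:C.
  by rewrite map_cblock [X in cblock _ _ _ X]complex.conjcK /= !oppr0.
rewrite /rho_hat rhoconj sigma22_conj mul_cblock mulr0 mul0r.
set b' := _ + _ * (pb p)%:C; set c' := _ + (pa p)%:C * _.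
set a' := _ + _ * conjc _; set d' := _ + _ * (pb p)%:C.
have a'E : a' = (pa p * pb p + pc p ^+ 2 / 4)%:C.
  by rewrite /a' coherence_conj; simpc; rewrite mulrC.
have d'E : d' = (pa p * pb p + pc p ^+ 2 / 4)%:C.
  by rewrite /d' mulrC coherence_conj; simpc; rewrite addrC.
have bcE : b' * c' = (pa p * pb p * pc p ^+ 2)%:C.
  (* The factor 4 is spelled out as a sum, so that only real embeddings remain after
     [coherence_conj]. *)
  have -> : b' * c' = (pa p)%:C * (pb p)%:C *
      (coherence p * conjc (coherence p) + coherence p * conjc (coherence p) +
       coherence p * conjc (coherence p) + coherence p * conjc (coherence p)).
    by rewrite /b' /c'; ring.
  by rewrite coherence_conj; simpc; congr (_ +i* _); field.
have c'0 : c' != 0.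
  apply/eqP => c'0; move: bcE; rewrite c'0 mulr0 => -[] /esym/eqP.
  by rewrite !mulf_eq0 !gt_eqF.
have [||||P MP] := @diag_by_cblock R 0 0
  ((s + pc p / 2) ^+ 2) ((s - pc p / 2) ^+ 2) a' b' c' d' => //.
- by apply/eqP; nra.
- by rewrite bcE a'E d'E; simpc; congr (_ +i* _); rewrite -sE; field.
- by rewrite bcE a'E d'E; simpc; congr (_ +i* _); rewrite -sE; field.
have {}MP := diag_by_mxfun (@Num.sqrt R) MP.
have e1 : Num.sqrt ((s + pc p / 2) ^+ 2) = s + pc p / 2.
  by rewrite sqrtr_sqr ger0_norm //; lra.
have e2 : Num.sqrt ((s - pc p / 2) ^+ 2) = s - pc p / 2.
  by rewrite sqrtr_sqr ger0_norm //; lra.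
rewrite (diag_by_tr MP) (diag_by_lambda_max (k := inord 1) MP); last first.
  move=> i; rewrite !mxE inordK //=.
  by case: i => -[|[|[|[|//]]]] ? /=; rewrite ?e1 ?e2 ?sqrtr0; lra.
rewrite !big_ord_recl big_ord0 !mxE inordK //= e1 e2 !sqrtr0.
by rewrite max_r; lra.
Qed.

(** * Transfer of differentials between locally equal functions, and a chain rule *)

Lemma near_eq_is_diff (R : numFieldType) (V W : normedModType R)
    (f g df : V -> W) (x : V) :
  (\near x, f x = g x) -> is_diff x f df -> is_diff x g df.
Proof.
move=> fg fdf.
have h0 : \near x, (g - f) x = 0.
  by apply: filterS fg => y e; rewrite !fctE e subrr.
have hx := nbhs_singleton h0.
(* The increment of [g - f] is zero near [x], so [g - f] has differential 0; then
   [g = f + (g - f)]. *)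
have hdf : (g - f) \o shift x = cst ((g - f) x) + \0 +o_ 0 id.
  apply/eqaddoP => e e0; move: h0; rewrite (near_shift 0) subr0.
  apply: filterS => y /= hy; rewrite hx !fctE in hy *.
  by rewrite hy (_ : \0 y = 0 :> W) // addr0 subr0 normr0 mulr_ge0 // ltW.
have h_cont : continuous (\0 : V -> W) by exact: cst_continuous.
have d0 := diff_unique (df := \0) h_cont hdf.
have diffh : is_diff x (g - f) 0.
  by apply: DiffDef => //; apply/diff_locallyP; rewrite d0.
have -> : g = f + (g - f) by rewrite addrC subrK.
exact: (is_diff_eq (is_diffD fdf diffh) (addr0 _)).
Qed.

(** Feeds the one-variable derivatives of [Num.sqrt] and [y * ln y] into differentials on the
    parameter space. *)
Lemma is_diff_comp1 (R : numFieldType) (V : normedModType R)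
    (f : R -> R) (g dg : V -> R) (x : V) (k : R) :
  is_diff x g dg -> is_derive (g x) 1 f k ->
  is_diff x (f \o g) (fun v => dg v * k).
Proof.
move=> gx [fx fk].
have df : differentiable f (g x) by apply/derivable1_diffP.
have fd : is_diff (g x) f (fun y => y * k).
  apply: DiffDef => //; apply/funext => y.
  by rewrite diff1E // derive1E fk.
exact: is_diff_eq.
Qed.

Lemma is_diff_coord (R : numFieldType) m n (M : 'M[R]_(m, n)) i j :
  is_diff M (fun N : 'M[R]_(m, n) => N i j) (fun N => N i j).
Proof.
have lin : linear (fun N : 'M[R]_(m, n) => N i j : R).
  by move=> k A B; rewrite !mxE.
pose L : {linear 'M[R]_(m, n) -> R} :=
  HB.pack (fun N : 'M[R]_(m, n) => N i j : R)
          (GRing.isLinear.Build _ _ _ _ _ lin).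
apply: DiffDef; first exact: differentiable_coord.
by rewrite (diff_lin (f := L)) //; exact: coord_continuous.
Qed.

Lemma is_derive_xlnx (R : realType) (x : R) :
  0 < x -> is_derive x 1 (fun y => y * ln y) (ln x + 1).
Proof.
move=> x0; have lnx := is_derive1_ln x0.
apply: is_derive_eq.
by rewrite /GRing.scale /= mulr1 divff ?gt_eqF // addrC.
Qed.

(** * The point of dependence and the differentials there *)

Definition crit_pt (R : realType) : 'rV[R]_4 :=
  \row_j [:: 5 / 14; 5 / 14; 3 / 7; 0]`_j.

Lemma crit_ptE (R : realType) :
  [/\ pa (crit_pt R) = 5 / 14, pb (crit_pt R) = 5 / 14
    & pc (crit_pt R) = 3 / 7].
Proof. by rewrite /pa /pb /pc !mxE !inordK. Qed.

Lemma is_diff_pa (R : realType) (p : 'rV[R]_4) : is_diff p (@pa R) (@pa R).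
Proof. exact: is_diff_coord. Qed.
Lemma is_diff_pb (R : realType) (p : 'rV[R]_4) : is_diff p (@pb R) (@pb R).
Proof. exact: is_diff_coord. Qed.
Lemma is_diff_pc (R : realType) (p : 'rV[R]_4) : is_diff p (@pc R) (@pc R).
Proof. exact: is_diff_coord. Qed.

(** Strict inequalities persist nearby, so the hypotheses of [S_tE] and [C_tE] hold on a whole
    neighbourhood. *)
Definition open_dom (R : realType) (p : 'rV[R]_4) :=
  [/\ 0 < pa p, 0 < pb p, pa p + pb p < 1, 0 < pc p < 1 &
      pc p < 4 * pa p * pb p].

Lemma near_open_dom (R : realType) (p : 'rV[R]_4) :
  open_dom p -> \near p, open_dom p.
Proof.
case=> a0 b0 ab /andP[c0 c1] cab.
have ac : @pa R @ p --> pa p by exact: coord_continuous.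
have bc : @pb R @ p --> pb p by exact: coord_continuous.
have cc : @pc R @ p --> pc p by exact: coord_continuous.
have abc : (fun q => pa q + pb q) @ p --> pa p + pb p by exact: cvgD ac bc.
have abm : (fun q => 4 * pa q * pb q - pc q) @ p --> 4 * pa p * pb p - pc p.
  exact: cvgB (cvgM (cvgM (cvg_cst _) ac) bc) cc.
have h : 0 < 4 * pa p * pb p - pc p by rewrite subr_gt0.
near=> q; split; [| | |apply/andP; split|rewrite -subr_gt0]; near: q.
- exact: (cvgr_gt _ ac).
- exact: (cvgr_gt _ bc).
- exact: (cvgr_lt _ abc).
- exact: (cvgr_gt _ cc).
- exact: (cvgr_lt _ cc).
- exact: (cvgr_gt _ abm).
Unshelve. all: by end_near. Qed.

Lemma open_dom_interior (R : realType) (p : 'rV[R]_4) :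
  open_dom p -> (param_dom R)° p.
Proof.
move=> /near_open_dom; apply: filterS => q [? ? ? /andP[? ?] ?].
by split; lra.
Qed.

Lemma open_crit (R : realType) : open_dom (crit_pt R).
Proof. by rewrite /open_dom; have [-> -> ->] := crit_ptE R; split; lra. Qed.

Lemma gap_crit (R : realType) : gap (crit_pt R) = 3 / 7.
Proof.
by rewrite /gap; have [-> -> ->] := crit_ptE R;
  rewrite subrr expr0n add0r sqrtr_sqr ger0_norm //; lra.
Qed.

(** At [a = b] the term [(a - b)^2] has zero differential, and [2 c dc / (2 gap)] is [dc] because
    the gap equals [c] there. *)
Lemma is_diff_gap_crit (R : realType) : is_diff (crit_pt R) (@gap R) (@pc R).
Proof.
have da := is_diff_pa (crit_pt R).
have db := is_diff_pb (crit_pt R).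
have dc := is_diff_pc (crit_pt R).
have dq : is_diff (crit_pt R) ((@pa R - @pb R) ^+ 2 + @pc R ^+ 2)
   (fun v => 2 * (3 / 7) * pc v).
  apply: (is_diff_eq (is_diffD (is_diffX _ (is_diffB da db)) (is_diffX _ dc))).
  apply/funext => v; rewrite !fctE.
  have [-> -> ->] := crit_ptE R; rewrite /GRing.scale /=; by field.
have g0 : 0 < ((@pa R - @pb R) ^+ 2 + @pc R ^+ 2) (crit_pt R).
  by rewrite !fctE; have [-> -> ->] := crit_ptE R; lra.
apply: (is_diff_eq (is_diff_comp1 dq (is_derive1_sqrt g0))).
apply/funext => v; rewrite -[Num.sqrt _]/(gap (crit_pt R)) gap_crit; by field.
Qed.

Lemma is_diff_C_t (R : realType) : is_diff (crit_pt R) (@C_t R) (@pc R).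
Proof.
apply: near_eq_is_diff (is_diff_pc (crit_pt R)).
apply: filterS (near_open_dom (open_crit R)) => q [? ? ? /andP[? ?] ?].
(* From [0 < c < 1] follows [c^2 < c < 4 a b]. *)
by rewrite C_tE //; nra.
Qed.

Lemma is_diff_S_t (R : realType) : is_diff (crit_pt R) (@S_t R)
  (fun v => (ln (4 / 7) - ln (1 / 7)) / 2 * pc v).
Proof.
have da := is_diff_pa (crit_pt R).
have db := is_diff_pb (crit_pt R).
have dr := is_diff_gap_crit R.
pose l1 : 'rV[R]_4 -> R := 2^-1 *: (@pa R + @pb R + @gap R).
pose l2 : 'rV[R]_4 -> R := 2^-1 *: (@pa R + @pb R - @gap R).
pose l3 : 'rV[R]_4 -> R := cst 1 - @pa R - @pb R.
have d1 : is_diff (crit_pt R) l1 (2^-1 *: (@pa R + @pb R + @pc R)) :=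
  is_diffZ _ (is_diffD (is_diffD da db) dr).
have d2 : is_diff (crit_pt R) l2 (2^-1 *: (@pa R + @pb R - @pc R)) :=
  is_diffZ _ (is_diffB (is_diffD da db) dr).
have d3 : is_diff (crit_pt R) l3 (cst 0 - @pa R - @pb R) :=
  is_diffB (is_diffB (is_diff_cst _ _) da) db.
have e1 : l1 (crit_pt R) = 4 / 7.
  by rewrite /l1 !fctE gap_crit; have [-> -> _] := crit_ptE R;
     rewrite /GRing.scale /=; field.
have e2 : l2 (crit_pt R) = 1 / 7.
  by rewrite /l2 !fctE gap_crit; have [-> -> _] := crit_ptE R;
     rewrite /GRing.scale /=; field.
have e3 : l3 (crit_pt R) = 2 / 7.
  by rewrite /l3 !fctE; have [-> -> _] := crit_ptE R; field.
have p1 : 0 < l1 (crit_pt R) by rewrite e1; lra.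
have p2 : 0 < l2 (crit_pt R) by rewrite e2; lra.
have p3 : 0 < l3 (crit_pt R) by rewrite e3; lra.
have x1 := is_diff_comp1 d1 (is_derive_xlnx p1).
have x2 := is_diff_comp1 d2 (is_derive_xlnx p2).
have x3 := is_diff_comp1 d3 (is_derive_xlnx p3).
(* This is [l1 * l2 = l3^2]: the eigenvalues are in the ratio 4 : 1 : 2. *)
have lnE : ln (4 / 7) + ln (1 / 7) = ln (2 / 7) + ln (2 / 7) :> R.
  by rewrite -!lnM ?posrE; [congr ln; field|lra..].
have x123 := is_diffD (is_diffD x1 x2) x3.
apply: (near_eq_is_diff _ (is_diff_eq x123 _)); last first.
  (* The [+ 1] in each derivative of [y * ln y] cancels, as [l1 + l2 + l3] is constant; [lnE] then
     removes the coefficient of [da + db]. *)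
  apply/funext => v; rewrite !fctE e1 e2 e3 /GRing.scale /=.
  have -> : ln (4 / 7) = ln (2 / 7) + ln (2 / 7) - ln (1 / 7) :> R.
    by rewrite -lnE addrK.
  by field.
apply: filterS (near_open_dom (open_crit R)) => q [_ _ _ /andP[c0 _] _].
rewrite S_tE ?gt_eqF // /l1 /l2 /l3 !fctE /GRing.scale /=.
by rewrite ![2^-1 * _]mulrC.
Qed.

(** Differentiability is recorded at the exhibited state so that the vanishing of the wedge does not
    rest on default values of ['d]. *)
Theorem lemma7 (R : realType) :
  ~ (forall p : 'rV[R]_4, (param_dom R)° p -> independent_at (@S_t R) (@C_t R) p)
  /\ [set rho_t p | p in [set p : 'rV[R]_4 |
        [/\ (param_dom R)° p,
            differentiable (@S_t R) p,
            differentiable (@C_t R) p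
          & dwedge (@S_t R) (@C_t R) p = (fun _ _ => 0)]]] !=set0.
Proof.
have dom0 := open_dom_interior (open_crit R).
have [dS SE] := is_diff_S_t R; have [dC CE] := is_diff_C_t R.
have wedge0 : dwedge (@S_t R) (@C_t R) (crit_pt R) = (fun _ _ => 0).
  (* Both differentials are multiples of [pc], so their antisymmetrised product vanishes. *)
  by apply/funext => u; apply/funext => v; rewrite /dwedge /wedge SE CE; ring.
split; first by move=> /(_ _ dom0).
by exists (rho_t (crit_pt R)), (crit_pt R).
Qed.
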